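(* Let $p \in [1, \infty)$, let $G$ be a countable discrete amenable group, let $A$ be a unital $L^p$ operator algebra which is nondegenerately $\sigma$-finitely representable, and let $\alpha \colon G \to \mathrm{Aut}(A)$ be an isometric action. Suppose that $A$ is amenable as a Banach algebra. Then $F^p(G, A, \alpha)$ and $F^p_{\mathrm r}(G, A, \alpha)$ are amenable as Banach algebras.
   Context: Amenability of a Banach algebra is in the usual sense (Johnson): every continuous derivation into a dual Banach bimodule is inner. $L(E)$ is the algebra of bounded operators on a Banach space $E$. An $L^p$ operator algebra is a Banach algebra isometrically isomorphic to a norm closed subalgebra of $L(L^p(X,\mu))$ for some measure space $(X,\mathcal B,\mu)$. A representation of $A$ on $L^p(X,\mu)$ is a continuous homomorphism $\pi\colon A\to L(L^p(X,\mu))$; it is contractive if $\|\pi(a)\|\le\|a\|$ for all $a$, isometric if $\|\pi(a)\|=\|a\|$ for all $a$, $\sigma$-finite if $\mu$ is $\sigma$-finite, and nondegenerate if the span of $\{\pi(a)\xi\}$ is dense. $A$ is nondegenerately $\sigma$-finitely representable if it has a nondegenerate $\sigma$-finite isometric representation. An isometric action of the discrete group $G$ on $A$ is a homomorphism from $G$ to the isometric automorphisms of $A$. A contractive covariant representation of $(G,A,\alpha)$ on $L^p(X,\mu)$ is a pair $(v,\pi)$ of a representation $v$ of $G$ by invertible operators with $\|v_g\|\le1$ and a contractive representation $\pi$ of $A$, both on $L^p(X,\mu)$, with $\pi(\alpha_g(a))=v_g\pi(a)v_g^{-1}$; it is nondegenerate or $\sigma$-finite if $\pi$ is. Given a contractive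 representation $\pi_0\colon A\to L(L^p(X,\mu))$, the associated regular covariant representation $(v,\pi)$ acts on $l^p(G,L^p(X,\mu))$ by $(v_g\xi)(h)=\xi(g^{-1}h)$ and $(\pi(a)\xi)(h)=\pi_0(\alpha_h^{-1}(a))(\xi(h))$. $C_{\mathrm c}(G,A,\alpha)$ is the algebra of finitely supported functions $G\to A$, written as finite sums $\sum_g a_gu_g$, with product determined by $(a u_g)(b u_h)=a\alpha_g(b)u_{gh}$; $(v\ltimes\pi)(\sum_g a_gu_g)=\sum_g\pi(a_g)v_g$. The full (respectively reduced) $L^p$ operator crossed product $F^p(G,A,\alpha)$ (respectively $F^p_{\mathrm r}(G,A,\alpha)$) is the Hausdorff completion of $C_{\mathrm c}(G,A,\alpha)$ in the seminorm $a\mapsto\sup\|(v\ltimes\pi)(a)\|$, over all nondegenerate $\sigma$-finite contractive covariant representations (respectively over all regular covariant representations coming from nondegenerate $\sigma$-finite contractive representations $\pi_0$ of $A$) on $L^p$ spaces. *)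

(* Defs.v *)
From HB Require Import structures.
From mathcomp Require Import all_boot all_order all_algebra.
From mathcomp Require Import all_classical all_reals all_analysis.
From mathcomp Require Import measurable_realfun complex ring.

Set Implicit Arguments.
Unset Strict Implicit.
Unset Printing Implicit Defensive.

Import Order.TTheory GRing.Theory Num.Theory.
Import numFieldNormedType.Exports.

Local Open Scope classical_set_scope.
Local Open Scope ring_scope.
Local Open Scope complex_scope.

(* Complex scalars are [R[i]] with [R : realType]. The norm of a
   [normedModType R[i]] takes its values in [R[i]] (in its nonnegative reals);
   [rnorm] is the same norm, with values in [R]. *)
Definition rnorm (R : realType) (V : normedModType R[i]) (x : V) : R :=
  complex.Re `|x|.

Lemma rnormE (R : realType) (V : normedModType R[i]) (x : V) :
  `|x| = (rnorm x)%:C.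
Proof. by rewrite /rnorm RRe_real// ger0_real. Qed.

Section RNorm.
Context (R : realType) (V : normedModType R[i]).
Implicit Types x y : V.

Lemma rnorm_le (W : normedModType R[i]) x (y : W) :
  (`|x| <= `|y|) = (rnorm x <= rnorm y).
Proof. by rewrite !rnormE lecR. Qed.

Lemma rnorm_ge0 x : 0 <= rnorm x.
Proof. by rewrite -lecR -rnormE; exact: normr_ge0. Qed.

Lemma rnormD x y : rnorm (x + y) <= rnorm x + rnorm y.
Proof. by rewrite -lecR rmorphD/= -!rnormE ler_normD. Qed.

Lemma rnormZ (a : R[i]) x : rnorm (a *: x) = Normc.normc a * rnorm x.
Proof.
by apply: (@complexI R); rewrite rmorphM/= -(rnormE x) -(rnormE (a *: x)) normrZ.
Qed.

Lemma rnorm0 : rnorm (0 : V) = 0.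
Proof. by rewrite /rnorm normr0. Qed.

Lemma rnorm_eq0 x : rnorm x = 0 -> x = 0.
Proof. by move=> x0; apply/eqP; rewrite -normr_eq0 rnormE x0. Qed.

End RNorm.

Section BoundedOperators.
Context (R : realType) (E F : normedModType R[i]).

Definition bounded_op : {pred E -> F} :=
  [pred T | `[< linear T /\ exists M : R, forall x, rnorm (T x) <= M * rnorm x >]].

Lemma bounded_opP (T : E -> F) : linear T ->
  (exists M : R, forall x, rnorm (T x) <= M * rnorm x) -> T \in bounded_op.
Proof. by move=> lT bT; exact/asboolP. Qed.

Lemma bounded_op_submod_closed : submod_closed bounded_op.
Proof.
split.
  apply: bounded_opP; first by move=> a x y; rewrite -[LHS]/(0 : F) scaler0 addr0.
  by exists 0 => x; rewrite mul0r -[_ x]/(0 : F) rnorm0.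
move=> a S T /asboolP[lS [M bS]] /asboolP[lT [N bT]].
apply: bounded_opP.
  move=> b x y; rewrite !fctE lS lT !scalerDr !scalerA mulrC -!addrA.
  by congr (_ + _); rewrite addrCA.
exists (Normc.normc a * M + N) => x; rewrite !fctE mulrDl.
apply: le_trans (rnormD _ _) _; apply: lerD => //.
rewrite rnormZ -mulrA ler_wpM2l//.
by case: (a) => u v /=; exact: sqrtr_ge0.
Qed.

HB.instance Definition _ :=
  GRing.isSubmodClosed.Build R[i] (E -> F) bounded_op bounded_op_submod_closed.

Record bop := Bop { bop_fun :> E -> F; bop_prop : bop_fun \in bounded_op }.

HB.instance Definition _ := [isSub for bop_fun].
HB.instance Definition _ := [Choice of bop by <:].
HB.instance Definition _ := [SubChoice_isSubLmodule of bop by <:].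

Implicit Types S T : bop.

Lemma bop_eqP S T : S =1 T -> S = T.
Proof. by move=> ST; apply/val_inj/funext. Qed.

Lemma bop_linear T : linear T.
Proof. by have /asboolP[] := bop_prop T. Qed.

Lemma bop0 T : T 0 = 0.
Proof.
have := bop_linear T 1 0 0; rewrite !scale1r addr0 => /eqP.
by rewrite -subr_eq0 opprD addNKr oppr_eq0 => /eqP.
Qed.

Lemma bopZ T a x : T (a *: x) = a *: T x.
Proof. by have := bop_linear T a x 0; rewrite bop0 !addr0. Qed.

Lemma bopD T x y : T (x + y) = T x + T y.
Proof. by have := bop_linear T 1 x y; rewrite !scale1r. Qed.

Definition opnorm T : R :=
  sup [set rnorm (T x) | x in [set x | rnorm x <= 1]].

Let values T := [set rnorm (T x) | x in [set x | rnorm x <= 1]].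

Let values_has_sup T : has_sup (values T).
Proof.
split; first by exists (rnorm (T 0)), 0 => //=; rewrite rnorm0.
have /asboolP[_ [M bT]] := bop_prop T.
exists `|M| => _ [x /= x1 <-]; apply: le_trans (bT x) _.
apply: (@le_trans _ _ (`|M| * rnorm x)).
  by rewrite ler_wpM2r ?rnorm_ge0// ler_norm.
by rewrite ler_piMr.
Qed.

Lemma opnorm_ge0 T : 0 <= opnorm T.
Proof.
apply: (sup_upper_bound (values_has_sup T)).
by exists 0; rewrite /= ?rnorm0 ?bop0 ?rnorm0.
Qed.

Lemma opnorm_bound T x : rnorm (T x) <= opnorm T * rnorm x.
Proof.
have [x0|x0] := eqVneq (rnorm x) 0.
  by rewrite (rnorm_eq0 x0) bop0 !rnorm0 mulr0.
have x_gt0 : 0 < rnorm x by rewrite lt_def x0 rnorm_ge0.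
rewrite -ler_pdivrMr//; apply: (sup_upper_bound (values_has_sup T)).
have nV : Normc.normc ((rnorm x)^-1)%:C = (rnorm x)^-1.
  by rewrite /= expr0n addr0 sqrtr_sqr ger0_norm// invr_ge0 rnorm_ge0.
exists (((rnorm x)^-1)%:C *: x); rewrite /= ?bopZ rnormZ nV ?mulVf//.
by rewrite mulrC.
Qed.

Lemma opnorm_le T M : 0 <= M -> (forall x, rnorm (T x) <= M * rnorm x) ->
  opnorm T <= M.
Proof.
move=> M0 bT; apply: ge_sup; first by case: (values_has_sup T).
move=> _ [x /= x1 <-]; apply: le_trans (bT x) _.
by rewrite ler_piMr.
Qed.

Let norm T : R[i] := (opnorm T)%:C.

Let ler_normD S T : norm (S + T) <= norm S + norm T.
Proof.
rewrite /norm -rmorphD lecR.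
apply: opnorm_le => [|x]; first by rewrite addr_ge0 ?opnorm_ge0.
by apply: le_trans (rnormD _ _) _; rewrite mulrDl lerD// opnorm_bound.
Qed.

Let opnormZ_le a T : opnorm (a *: T) <= Normc.normc a * opnorm T.
Proof.
have a0 : 0 <= Normc.normc a by case: (a) => u v /=; exact: sqrtr_ge0.
apply: opnorm_le => [|x]; first by rewrite mulr_ge0 ?opnorm_ge0.
by rewrite [(_ *: T) x]/(a *: T x) rnormZ -mulrA ler_wpM2l// opnorm_bound.
Qed.

Let normrZ (a : R[i]) T : norm (a *: T) = `|a| * norm T.
Proof.
rewrite /norm -[`|a|]/((Normc.normc a)%:C) -rmorphM/=; congr (_%:C).
apply/eqP; rewrite eq_le opnormZ_le/=.
have [->|a0] := eqVneq a 0; first by rewrite Normc.normc0 mul0r opnorm_ge0.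
have an0 : Normc.normc a != 0 by apply: contra a0 => /eqP/Normc.eq0_normc ->.
have a_gt0 : 0 < Normc.normc a.
  by rewrite lt_def an0; case: (a) => u v /=; exact: sqrtr_ge0.
have := opnormZ_le a^-1 (a *: T).
by rewrite scalerA mulVf// scale1r Normc.normcV mulrC ler_pdivlMr// mulrC.
Qed.

Let normr0_eq0 T : norm T = 0 -> T = 0.
Proof.
move=> /complexI T0; apply: bop_eqP => x; apply: rnorm_eq0.
apply/eqP; rewrite eq_le rnorm_ge0 andbT.
by apply: le_trans (opnorm_bound T x) _; rewrite T0 mul0r.
Qed.

HB.instance Definition _ :=
  Lmodule_isNormed.Build R[i] bop ler_normD normrZ normr0_eq0.

Lemma bop_normE T : `|T| = (opnorm T)%:C. Proof. by []. Qed.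

Lemma bop_rnormE T : rnorm T = opnorm T. Proof. by []. Qed.

End BoundedOperators.
Section Composition.
Context (R : realType) (E F H : normedModType R[i]).

Lemma bcomp_subproof (S : bop F H) (T : bop E F) :
  (S : F -> H) \o T \in @bounded_op R E H.
Proof.
apply: bounded_opP => [a x y /=|]; first by rewrite !bop_linear.
exists (opnorm S * opnorm T) => x /=; apply: le_trans (opnorm_bound S _) _.
by rewrite -mulrA ler_wpM2l ?opnorm_ge0 ?opnorm_bound.
Qed.

Definition bcomp (S : bop F H) (T : bop E F) : bop E H := Bop (bcomp_subproof S T).

Lemma bid_subproof : idfun \in @bounded_op R E E.
Proof.
apply: bounded_opP => [a x y //|].
by exists 1 => x; rewrite mul1r.
Qed.

Definition bid : bop E E := Bop bid_subproof.

End Composition.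
Arguments bid {R} E.
Notation "S \bo T" := (bcomp S T) (at level 50, left associativity).

Reserved Notation "x ** y" (at level 40, left associativity).

(* [bmul] need not have a unit. *)
HB.mixin Record isBanachAlgebra (K : numFieldType) A
    & CompleteNormedModule K A := {
  bmul : A -> A -> A;
  bmulA : associative bmul;
  bmul_linearl : forall b, linear (bmul^~ b);
  bmul_linearr : forall a, linear (bmul a);
  ler_normBM : forall a b, `|bmul a b| <= `|a| * `|b|
}.

#[short(type="banachAlgType")]
HB.structure Definition BanachAlgebra (K : numFieldType) :=
  {A of CompleteNormedModule K A & isBanachAlgebra K A}.

Notation "x ** y" := (bmul x y) : ring_scope.

Definition unital (K : numFieldType) (A : banachAlgType K) :=
  exists e : A, forall a, e ** a = a /\ a ** e = a.

Record banach_bimodule (R : realType) (A : banachAlgType R[i])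
    (X : completeNormedModType R[i]) := BanachBimodule {
  lact : A -> X -> X;
  ract : X -> A -> X;
  lact_linearl : forall x, linear (lact^~ x);
  lact_linearr : forall a, linear (lact a);
  ract_linearl : forall a, linear (ract^~ a);
  ract_linearr : forall x, linear (ract x);
  lactA : forall a b x, lact (a ** b) x = lact a (lact b x);
  ractA : forall x a b, ract x (a ** b) = ract (ract x a) b;
  lractA : forall a x b, ract (lact a x) b = lact a (ract x b);
  act_bounded : exists M : R, forall a x,
    rnorm (lact a x) <= M * rnorm a * rnorm x /\
    rnorm (ract x a) <= M * rnorm a * rnorm x
}.

Definition dual (R : realType) (X : normedModType R[i]) := bop X (R[i])^o.

Section DualBimodule.
Context (R : realType) (A : banachAlgType R[i]) (X : completeNormedModType R[i]).
Variable M : banach_bimodule A X.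

Lemma lact_op_subproof a : lact M a \in @bounded_op R X X.
Proof.
apply: bounded_opP; first exact: lact_linearr.
have [K bK] := act_bounded M.
by exists (K * rnorm a) => x; have [] := bK a x.
Qed.

Lemma ract_op_subproof a : (ract M)^~ a \in @bounded_op R X X.
Proof.
apply: bounded_opP; first exact: ract_linearl.
have [K bK] := act_bounded M.
by exists (K * rnorm a) => x; have [] := bK a x.
Qed.

Definition dual_lact (a : A) (phi : dual X) : dual X :=
  phi \bo Bop (ract_op_subproof a).

Definition dual_ract (phi : dual X) (a : A) : dual X :=
  phi \bo Bop (lact_op_subproof a).

Definition derivation (D : A -> dual X) : Prop :=
  linear D /\ forall a b, D (a ** b) = dual_lact a (D b) + dual_ract (D a) b.

Definition inner_derivation (D : A -> dual X) : Prop :=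
  exists phi : dual X, forall a, D a = dual_lact a phi - dual_ract phi a.

End DualBimodule.

Definition amenable (R : realType) (A : banachAlgType R[i]) : Prop :=
  forall (X : completeNormedModType R[i]) (M : banach_bimodule A X)
    (D : A -> dual X),
  derivation M D -> continuous D -> inner_derivation M D.

Definition linspan (K : numFieldType) (E : normedModType K) (S : set E) : set E :=
  [set x | exists (n : nat) (c : 'I_n -> K) (s : 'I_n -> E),
    (forall i, S (s i)) /\ x = \sum_(i < n) c i *: s i].

Record contractive_rep (R : realType) (A : banachAlgType R[i])
    (E : normedModType R[i]) := ContractiveRep {
  crep :> A -> bop E E;
  crep_linear : linear crep;
  crepM : forall a b, crep (a ** b) = crep a \bo crep b;
  crep_contractive : forall a, `|crep a| <= `|a|
}.

Definition isometric_rep (R : realType) (A : banachAlgType R[i])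
    (E : normedModType R[i]) (pi : contractive_rep A E) : Prop :=
  forall a, `|pi a| = `|a|.

Definition nondegenerate (R : realType) (A : banachAlgType R[i])
    (E : normedModType R[i]) (pi : contractive_rep A E) : Prop :=
  dense (linspan [set y | exists a x, y = pi a x]).

(* [m] is only meaningful on bounded functions, where it is a left-invariant
   mean. *)
Definition amenable_group (R : realType) (G : groupType) : Prop :=
  let bounded_fun (f : G -> R) := exists M : R, forall g, `|f g| <= M in
  exists m : (G -> R) -> R,
  [/\ forall (c : R) f1 f2, bounded_fun f1 -> bounded_fun f2 ->
        m (fun g => c * f1 g + f2 g) = c * m f1 + m f2,
      forall f, bounded_fun f -> (forall g, 0 <= f g) -> 0 <= m f,
      m (cst 1) = 1 &
      forall f h, bounded_fun f -> m (fun g => f (h * g)%g) = m f].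
Lemma normc_ge0 (R : realType) (z : R[i]) : 0 <= Normc.normc z.
Proof. by case: z => u v /=; exact: sqrtr_ge0. Qed.

Section Lp.
Context d (X : measurableType d) (R : realType).
Variables (mu : {measure set X -> \bar R}) (p : R).
Implicit Types f g : X -> R[i].

(* Borel measurability of a complex-valued function, through its real and
   imaginary parts *)
Definition cmeasurable f : Prop :=
  measurable_fun setT (fun x => complex.Re (f x)) /\
  measurable_fun setT (fun x => complex.Im (f x)).

Definition Lp_norm f : \bar R := Lnorm mu p%:E (fun x => (Normc.normc (f x))%:E).

Lemma cmeasurable0 : cmeasurable (0 : X -> R[i]).
Proof. by split; exact: measurable_cst. Qed.

Lemma cmeasurableD f g : cmeasurable f -> cmeasurable g -> cmeasurable (f + g).
Proof.
move=> [rf jf] [rg jg]; split.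
- rewrite (_ : (fun _ => _) =
    (fun x => complex.Re (f x)) \+ (fun x => complex.Re (g x))).
    exact: measurable_funD.
  by apply/funext => x; rewrite fctE /=; case: (f x) (g x) => ? ? [].
- rewrite (_ : (fun _ => _) =
    (fun x => complex.Im (f x)) \+ (fun x => complex.Im (g x))).
    exact: measurable_funD.
  by apply/funext => x; rewrite fctE /=; case: (f x) (g x) => ? ? [].
Qed.

Lemma cmeasurableZ (a : R[i]) f : cmeasurable f -> cmeasurable (a *: f).
Proof.
case: a => u v [rf jf]; split.
- rewrite (_ : (fun _ => _) =
    (fun x => u * complex.Re (f x)) \- (fun x => v * complex.Im (f x))).
    by apply: measurable_funB; apply: measurable_funM.
  by apply/funext => x; rewrite fctE /=; case: (f x).
- rewrite (_ : (fun _ => _) =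
    (fun x => u * complex.Im (f x)) \+ (fun x => v * complex.Re (f x))).
    by apply: measurable_funD; apply: measurable_funM.
  by apply/funext => x; rewrite fctE /=; case: (f x).
Qed.

Lemma measurable_normc f : cmeasurable f ->
  measurable_fun setT (fun x => Normc.normc (f x)).
Proof.
move=> [rf jf].
rewrite (_ : (fun _ => _) = (fun x =>
  (complex.Re (f x) ^+ 2 + complex.Im (f x) ^+ 2) `^ 2^-1)); last first.
  by apply/funext => x; rewrite powR12_sqrt ?addr_ge0 ?sqr_ge0//; case: (f x).
apply: (@measurableT_comp _ _ _ _ _ _ (@powR R ^~ 2^-1)) => //.
by apply: measurable_funD; apply: measurable_funX.
Qed.

Lemma Lp_norm_ge0 f : (0 <= Lp_norm f)%E.
Proof. exact: Lnorm_ge0. Qed.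

Hypothesis p1 : 1 <= p.

Definition Lp_pred (_ : 1 <= p) : {pred X -> R[i]} :=
  [pred f | `[< cmeasurable f /\ (Lp_norm f < +oo)%E >]].

Let p_gt0 : 0 < p. Proof. exact: lt_le_trans p1. Qed.

Lemma Lp_norm0 : Lp_norm (0 : X -> R[i]) = 0%E.
Proof.
rewrite -(@Lnorm0 _ X R mu p%:E); last by rewrite eqe gt_eqF.
by apply: eq_Lnorm => x; rewrite -[(0 : X -> R[i]) x]/(0 : R[i]) Normc.normc0.
Qed.

Let mpow (h : X -> R) : measurable_fun setT h ->
  measurable_fun setT (fun x => (`|(h x)%:E| `^ p)%E).
Proof.
move=> mh; rewrite (_ : (fun _ => _) = EFin \o (fun x => `|h x| `^ p)) //.
apply/measurable_EFinP.
apply: (@measurableT_comp _ _ _ _ _ _ (@powR R ^~ p)) => //.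
exact: measurableT_comp.
Qed.

Lemma Lp_normD f g : cmeasurable f -> cmeasurable g ->
  (Lp_norm (f + g)%R <= Lp_norm f + Lp_norm g)%E.
Proof.
move=> mf mg.
have := minkowski_EFin mu (measurable_normc mf) (measurable_normc mg) p1.
apply: le_trans; rewrite /Lp_norm unlock.
apply: gt0_ler_poweR; first by rewrite invr_ge0 ltW.
- by rewrite in_itv/= leey integral_ge0// => x _; exact: poweR_ge0.
- by rewrite in_itv/= leey integral_ge0// => x _; exact: poweR_ge0.
apply: ge0_le_integral => //.
- by move=> x _; exact: poweR_ge0.
- exact: (mpow (measurable_normc (cmeasurableD mf mg))).
- exact: (mpow (measurable_funD (measurable_normc mf) (measurable_normc mg))).
move=> x _; apply: gt0_ler_poweR; [exact: ltW| | |].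
- by rewrite in_itv/= leey andbT lee_fin normr_ge0.
- by rewrite in_itv/= leey andbT lee_fin normr_ge0.
rewrite /= lee_fin.
rewrite !ger0_norm ?normc_ge0 ?addr_ge0 ?normc_ge0//.
by rewrite -lecR rmorphD/=; exact: (@ler_normD _ R[i]).
Qed.

Lemma Lp_normZ (a : R[i]) f : cmeasurable f ->
  (Lp_norm (a *: f)%R = (Normc.normc a)%:E * Lp_norm f)%E.
Proof.
move=> mf; rewrite /Lp_norm unlock.
under eq_integral => x _.
  rewrite (_ : Normc.normc _ = Normc.normc a * Normc.normc (f x)); last first.
    by rewrite -Normc.normcM.
  rewrite EFinM abseM poweRM// abse_EFin ger0_norm ?normc_ge0//.
  over.
rewrite ge0_integralZl//; last 3 first.
- exact: (mpow (measurable_normc mf)).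
- by move=> x _; exact: poweR_ge0.
- exact: poweR_ge0.
rewrite poweRM ?poweR_ge0//; last by apply: integral_ge0 => x _; exact: poweR_ge0.
by rewrite -poweRrM mulfV ?gt_eqF// poweRe1 ?lee_fin ?normc_ge0.
Qed.

Lemma Lp_pred_submod_closed : submod_closed (Lp_pred p1).
Proof.
split; first by apply/asboolP; split; [exact: cmeasurable0|rewrite Lp_norm0 ltry].
move=> a f g /asboolP[mf Nf] /asboolP[mg Ng]; apply/asboolP; split.
  by apply: cmeasurableD => //; exact: cmeasurableZ.
apply: le_lt_trans (Lp_normD (cmeasurableZ _ mf) mg) _.
by rewrite lte_add_pinfty// Lp_normZ// lte_mul_pinfty ?lee_fin ?normc_ge0.
Qed.

Lemma Lp_norm_eq0 f : cmeasurable f ->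
  Lp_norm f = 0%E <-> {ae mu, forall x, f x = 0}.
Proof.
move=> mf; have mn := measurable_normc mf; split => [f0|f0].
  have := @Lnorm_eq0_eq0 _ _ _ mu _ p%:E _ _ f0.
  move=> /(_ _ _)/wrap[|//|]; first exact/measurable_EFinP.
  by apply: filterS => x /(_ I)[] /Normc.eq0_normc.
rewrite /Lp_norm unlock (ae_eq_integral (cst 0%E))//.
- by rewrite integral_cst// mul0e poweR0r// invr_neq0// gt_eqF.
- exact: (mpow mn).
- apply: filterS f0 => x -> _ /=.
  by rewrite expr0n addr0 sqrtr0 normr0 powR0// gt_eqF.
Qed.

HB.instance Definition _ := GRing.isSubmodClosed.Build R[i] (X -> R[i])
  (Lp_pred p1) Lp_pred_submod_closed.

Record Lp_fun := LpFun { Lp_fun_fun :> X -> R[i]; _ : Lp_fun_fun \in Lp_pred p1 }.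

HB.instance Definition _ := [isSub for Lp_fun_fun].
HB.instance Definition _ := [Choice of Lp_fun by <:].
HB.instance Definition _ := [SubChoice_isSubLmodule of Lp_fun by <:].

Lemma Lp_fun_measurable (f : Lp_fun) : cmeasurable f.
Proof. by case: f => f /= /asboolP[]. Qed.

Lemma Lp_fun_fin (f : Lp_fun) : (Lp_norm f < +oo)%E.
Proof. by case: f => f /= /asboolP[]. Qed.

Definition Lp_null : {pred Lp_fun} :=
  [pred f : Lp_fun | `[< {ae mu, forall x, f x = 0} >]].

Lemma Lp_null_submod_closed : submod_closed Lp_null.
Proof.
split; first by apply/asboolP; exact: nearW.
move=> a f g /asboolP f0 /asboolP g0; apply/asboolP.
apply: filterS2 f0 g0 => x f0 g0.
by rewrite -[LHS]/(a * f x + g x) f0 g0 mulr0 addr0.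
Qed.

HB.instance Definition _ := GRing.isSubmodClosed.Build R[i] Lp_fun
  Lp_null Lp_null_submod_closed.

Definition Lp : Type := Quotient.quot Lp_null.
HB.instance Definition _ := GRing.Zmodule.on Lp.
HB.instance Definition _ := EqQuotient.on Lp.

Local Open Scope quotient_scope.

Definition Lp_class (f : Lp_fun) : Lp := \pi_Lp f.

Let classP (f g : Lp_fun) : Lp_class f = Lp_class g <-> f - g \in Lp_null.
Proof. by rewrite Quotient.idealrBE; split => [/eqP|/eqP]. Qed.

Lemma Lp_class_eq (f g : Lp_fun) :
  Lp_class f = Lp_class g <-> {ae mu, forall x, f x = g x}.
Proof.
rewrite classP; split => [/asboolP|] fg; last apply/asboolP.
  by apply: filterS fg => x /eqP; rewrite subr_eq0 => /eqP.
by apply: filterS fg => x fg; rewrite -[LHS]/(f x - g x) fg subrr.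
Qed.

Let reprK (x : Lp) : Lp_class (repr x) = x. Proof. exact: reprK. Qed.

Let classD (f g : Lp_fun) : Lp_class (f + g) = Lp_class f + Lp_class g.
Proof. by rewrite /Lp_class !piE. Qed.

Definition Lp_scale (a : R[i]) (x : Lp) : Lp := Lp_class (a *: repr x).

Let classZ a (f : Lp_fun) : Lp_class (a *: f) = Lp_scale a (Lp_class f).
Proof.
apply/classP; rewrite -scalerBr; apply: rpredZ; apply/classP.
by rewrite reprK.
Qed.

Let scaleA a b x : Lp_scale a (Lp_scale b x) = Lp_scale (a * b) x.
Proof. by rewrite [Lp_scale b x]/Lp_scale -classZ scalerA. Qed.

Let scale1 x : Lp_scale 1 x = x.
Proof. by rewrite /Lp_scale scale1r reprK. Qed.

Let scaleDr a x y : Lp_scale a (x + y) = Lp_scale a x + Lp_scale a y.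
Proof.
by rewrite -[x in LHS]reprK -[y in LHS]reprK -classD -classZ scalerDr classD.
Qed.

Let scaleDl x a b : Lp_scale (a + b) x = Lp_scale a x + Lp_scale b x.
Proof. by rewrite /Lp_scale scalerDl classD. Qed.

HB.instance Definition _ := GRing.Zmodule_isLmodule.Build R[i] Lp
  scaleA scale1 scaleDr scaleDl.

Lemma Lp_class_linear : linear Lp_class.
Proof. by move=> a f g; rewrite classD classZ. Qed.

Let nrm (x : Lp) : R[i] := (fine (Lp_norm (repr x)))%:C.

Let fineN (f : Lp_fun) : (fine (Lp_norm f))%:E = Lp_norm f.
Proof. by rewrite fineK// ge0_fin_numE ?Lp_norm_ge0// Lp_fun_fin. Qed.

Let nrm_class (f : Lp_fun) : nrm (Lp_class f) = (fine (Lp_norm f))%:C.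
Proof.
suff le (g h : Lp_fun) : {ae mu, forall x, g x = h x} -> (Lp_norm g <= Lp_norm h)%E.
  congr (_%:C); congr fine; apply/eqP; rewrite eq_le.
  have fE : {ae mu, forall x, repr (Lp_class f) x = f x}.
    by apply/Lp_class_eq; rewrite reprK.
  apply/andP; split; apply: le => //.
  by apply: filterS fE.
move=> gh; have -> : (g : X -> R[i]) = (g - h) + h by rewrite subrK.
apply: le_trans (Lp_normD _ _) _; try exact: Lp_fun_measurable.
rewrite (Lp_norm_eq0 _).2 ?add0e//; first exact: Lp_fun_measurable.
by apply: filterS gh => x ghx; rewrite -[LHS]/(g x - h x) ghx subrr.
Qed.

Let ler_nrmD (x y : Lp) : nrm (x + y) <= nrm x + nrm y.
Proof.
rewrite -[x]reprK -[y]reprK -classD !nrm_class -rmorphD lecR -lee_fin EFinD !fineN.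
exact: (Lp_normD (Lp_fun_measurable (repr x)) (Lp_fun_measurable (repr y))).
Qed.

Let nrmZ (a : R[i]) (x : Lp) : nrm (a *: x) = `|a| * nrm x.
Proof.
rewrite -[x]reprK -[_ *: _]classZ !nrm_class -[`|a|]/((Normc.normc a)%:C) -rmorphM.
congr (_%:C); apply: EFin_inj; rewrite EFinM !fineN.
exact: (Lp_normZ a (Lp_fun_measurable (repr x))).
Qed.

Let nrm_eq0 (x : Lp) : nrm x = 0 -> x = 0.
Proof.
rewrite -[x]reprK nrm_class => /complexI f0.
have -> : 0 = Lp_class 0 by rewrite /Lp_class !piE.
apply/Lp_class_eq/Lp_norm_eq0; first exact: Lp_fun_measurable.
by rewrite -fineN f0.
Qed.

HB.instance Definition _ :=
  Lmodule_isNormed.Build R[i] Lp ler_nrmD nrmZ nrm_eq0.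

Lemma Lp_class_rnorm (f : Lp_fun) : rnorm (Lp_class f) = fine (Lp_norm f).
Proof. by rewrite /rnorm -[`|_|]/(nrm _) nrm_class. Qed.

End Lp.
Section LittleLp.
Context (I : choiceType) (R : realType) (E : normedModType R[i]).
Variables (p : R) (p1 : 1 <= p).
Implicit Types xi eta : I -> E.

Let p_gt0 : 0 < p. Proof. exact: lt_le_trans p1. Qed.
Let p_ge0 : 0 <= p. Proof. exact: ltW. Qed.
Let p_neq0 : p != 0. Proof. by rewrite gt_eqF. Qed.

Definition lp_sum xi : \bar R := \esum_(i in [set: I]) (rnorm (xi i) `^ p)%:E.

Definition lp_pred (_ : 1 <= p) : {pred I -> E} :=
  [pred xi | `[< (lp_sum xi < +oo)%E >]].

Lemma lp_sum_ge0 xi : (0 <= lp_sum xi)%E.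
Proof. by apply: esum_ge0 => i _; rewrite lee_fin powR_ge0. Qed.

Let esum_le_mul (a b : I -> \bar R) (c : R) : 0 <= c ->
  (forall i, 0 <= a i)%E -> (forall i, b i <= c%:E * a i)%E ->
  (\esum_(i in [set: I]) b i <= c%:E * \esum_(i in [set: I]) a i)%E.
Proof.
move=> c0 a0 ba; apply: ge_ereal_sup => _ [F [finF _] <-].
apply: le_trans (lee_fsum _ (fun i _ => ba i)) _ => //.
rewrite -ge0_mule_fsumr//; apply: lee_wpmul2l; rewrite ?lee_fin//.
by apply: esum_ge; exists F => //; split.
Qed.

Lemma lp_sum_le_mul xi eta (c : R) : 0 <= c ->
  (forall i, rnorm (eta i) <= c * rnorm (xi i)) ->
  (lp_sum eta <= (c `^ p)%:E * lp_sum xi)%E.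
Proof.
move=> c0 le; apply: esum_le_mul => [|i|i]; first exact: powR_ge0.
- by rewrite lee_fin powR_ge0.
- rewrite -EFinM lee_fin -powRM ?rnorm_ge0//.
  by apply: ge0_ler_powR; rewrite ?nnegrE ?mulr_ge0 ?rnorm_ge0.
Qed.

Definition lp_norm xi : R := fine (lp_sum xi) `^ p^-1.

Lemma lp_norm_ge0 xi : 0 <= lp_norm xi. Proof. exact: powR_ge0. Qed.

Let lp_normK xi : (lp_sum xi < +oo)%E -> (lp_norm xi `^ p)%:E = lp_sum xi.
Proof.
move=> fin; rewrite -powRrM mulVf// powRr1; last by rewrite fine_ge0 ?lp_sum_ge0.
by rewrite fineK// ge0_fin_numE// lp_sum_ge0.
Qed.

Lemma lp_norm_eq0 xi : (lp_sum xi < +oo)%E -> lp_norm xi = 0 -> xi = 0.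
Proof.
move=> fin n0; apply/funext => i; apply: rnorm_eq0; apply/eqP.
have : ((rnorm (xi i) `^ p)%:E <= lp_sum xi)%E.
  by apply: esum_ge; exists [set i]; [split|rewrite fsbig_set1].
rewrite -lp_normK// n0 powR0// lee_fin => le0.
have /eqP := le_anti (introT andP (conj le0 (powR_ge0 _ _))).
by rewrite powR_eq0 => /andP[].
Qed.

Let powR_conv (l x y : R) : 0 <= l <= 1 -> 0 <= x -> 0 <= y ->
  (l * x + (1 - l) * y) `^ p <= l * x `^ p + (1 - l) * y `^ p.
Proof.
move=> /andP[l0 l1] x0 y0.
have := convex_powR p1 (Itv01 l0 l1) (x := x) (y := y).
by apply; rewrite inE/= in_itv/= andbT.
Qed.

Lemma lp_sumD xi eta : (lp_sum xi < +oo)%E -> (lp_sum eta < +oo)%E ->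
  (lp_sum (xi + eta)%R <= ((lp_norm xi + lp_norm eta) `^ p)%:E)%E.
Proof.
move=> fxi feta.
have [s0|s0] := eqVneq (lp_norm xi) 0.
  by rewrite s0 (lp_norm_eq0 fxi s0) !add0r lp_normK.
have [t0|t0] := eqVneq (lp_norm eta) 0.
  by rewrite t0 (lp_norm_eq0 feta t0) !addr0 lp_normK.
move: s0 t0 (lp_normK fxi) (lp_normK feta) (lp_norm_ge0 xi) (lp_norm_ge0 eta).
move: (lp_norm xi) (lp_norm eta) => s t s0 t0 sK tK s_ge0 t_ge0.
have s_gt0 : 0 < s by rewrite lt_def s0.
have t_gt0 : 0 < t by rewrite lt_def t0.
have st_gt0 : 0 < s + t by rewrite addr_gt0.
have st_neq0 : s + t != 0 by rewrite gt_eqF.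
have [l lE] : exists l, l = s / (s + t) by eexists.
have l1E : 1 - l = t / (s + t).
  by rewrite lE; field.
have l01 : 0 <= l <= 1.
  rewrite lE divr_ge0 ?(ltW s_gt0) ?(ltW st_gt0)//=.
  by rewrite ler_pdivrMr// mul1r lerDl ltW.
pose c1 := (s + t) `^ p * l * (s^-1) `^ p.
pose c2 := (s + t) `^ p * (1 - l) * (t^-1) `^ p.
have l0 : 0 <= l by case/andP: l01.
have l1 : 0 <= 1 - l by rewrite subr_ge0; case/andP: l01.
have c10 : 0 <= c1.
  by apply: mulr_ge0; [apply: mulr_ge0|] => //; exact: powR_ge0.
have c20 : 0 <= c2.
  by apply: mulr_ge0; [apply: mulr_ge0|] => //; exact: powR_ge0.
have ptw i : rnorm ((xi + eta) i) `^ p <=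
    c1 * rnorm (xi i) `^ p + c2 * rnorm (eta i) `^ p.
  have si0 : 0 <= s^-1 by rewrite invr_ge0.
  have ti0 : 0 <= t^-1 by rewrite invr_ge0.
  have x0 : 0 <= s^-1 * rnorm (xi i) by apply: mulr_ge0 => //; exact: rnorm_ge0.
  have y0 : 0 <= t^-1 * rnorm (eta i) by apply: mulr_ge0 => //; exact: rnorm_ge0.
  have xy0 : 0 <= l * (s^-1 * rnorm (xi i)) + (1 - l) * (t^-1 * rnorm (eta i)).
    by apply: addr_ge0; exact: mulr_ge0.
  have st0 : 0 <= s + t by exact: ltW.
  apply: (@le_trans _ _ ((s + t) `^ p *
      (l * (s^-1 * rnorm (xi i)) + (1 - l) * (t^-1 * rnorm (eta i))) `^ p)).
    rewrite -(powRM _ st0 xy0).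
    apply: ge0_ler_powR; rewrite ?nnegrE//; [exact: rnorm_ge0|exact: mulr_ge0|].
    apply: le_trans (rnormD _ _) _; rewrite l1E lE le_eqVlt; apply/orP; left.
    by apply/eqP; field; rewrite st_neq0 t0 s0.
  rewrite /c1 /c2 -!mulrA -!mulrDr; apply: ler_wpM2l; first exact: powR_ge0.
  rewrite -(powRM _ si0 (rnorm_ge0 _)) -(powRM _ ti0 (rnorm_ge0 _)).
  exact: powR_conv.
apply: (@le_trans _ _ (c1%:E * lp_sum xi + c2%:E * lp_sum eta)%E).
  apply: (@le_trans _ _ (\esum_(i in [set: I])
      ((c1 * rnorm (xi i) `^ p)%:E + (c2 * rnorm (eta i) `^ p)%:E))%E).
    by apply: le_esum => i _; rewrite -EFinD lee_fin.
  rewrite esumD; try by move=> i _; rewrite lee_fin mulr_ge0 ?powR_ge0.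
  apply: leeD; apply: esum_le_mul => // i; rewrite ?lee_fin ?powR_ge0//.
rewrite -sK -tK -!EFinM -EFinD lee_fin.
rewrite /c1 /c2 -!mulrA -!powRM ?invr_ge0 ?(ltW s_gt0) ?(ltW t_gt0)//.
by rewrite !mulVf// powR1 !mulr1 -mulrDr subrKC mulr1.
Qed.

Lemma lp_pred_submod_closed : submod_closed (lp_pred p1).
Proof.
split.
  apply/asboolP; rewrite /lp_sum esum1// => i _.
  by rewrite -[_ i]/(0 : E) rnorm0 powR0.
move=> a xi eta /asboolP fxi /asboolP feta; apply/asboolP.
have faxi : (lp_sum (a *: xi)%R < +oo)%E.
  apply: (@le_lt_trans _ _ ((Normc.normc a `^ p)%:E * lp_sum xi)%E).
    apply: lp_sum_le_mul => [|i]; first exact: normc_ge0.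
    by rewrite -rnormZ.
  by rewrite lte_mul_pinfty// lee_fin powR_ge0.
exact: le_lt_trans (lp_sumD faxi feta) (ltry _).
Qed.

HB.instance Definition _ := GRing.isSubmodClosed.Build R[i] (I -> E)
  (lp_pred p1) lp_pred_submod_closed.

Record lp := LittleLp { lp_fun :> I -> E; lp_prop : lp_fun \in lp_pred p1 }.

HB.instance Definition _ := [isSub for lp_fun].
HB.instance Definition _ := [Choice of lp by <:].
HB.instance Definition _ := [SubChoice_isSubLmodule of lp by <:].

Lemma lp_eqP (xi eta : lp) : xi =1 eta -> xi = eta.
Proof. by move=> e; apply/val_inj/funext. Qed.

Lemma lp_fin (xi : lp) : (lp_sum xi < +oo)%E.
Proof. exact/asboolP/lp_prop. Qed.

Lemma lp_norm_le_mul (xi eta : lp) (c : R) : 0 <= c ->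
  (forall i, rnorm (eta i) <= c * rnorm (xi i)) ->
  lp_norm eta <= c * lp_norm xi.
Proof.
move=> c0 le; have := lp_sum_le_mul c0 le.
rewrite -(lp_normK (lp_fin xi)) -(lp_normK (lp_fin eta)) -EFinM lee_fin.
rewrite -(powRM _ c0 (lp_norm_ge0 xi)) => lep.
rewrite -[leLHS]powRr1 ?lp_norm_ge0// -[leRHS]powRr1 ?mulr_ge0 ?lp_norm_ge0//.
rewrite -(mulfV p_neq0) !powRrM.
by apply: ge0_ler_powR; rewrite ?nnegrE ?powR_ge0 ?invr_ge0.
Qed.

Let nrm (xi : lp) : R[i] := (lp_norm xi)%:C.

Let ler_nrmD (xi eta : lp) : nrm (xi + eta) <= nrm xi + nrm eta.
Proof.
rewrite /nrm -rmorphD lecR.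
have := lp_sumD (lp_fin xi) (lp_fin eta).
rewrite -(lp_normK (lp_fin (xi + eta))) lee_fin => lep.
rewrite -[leLHS]powRr1 ?lp_norm_ge0// -[leRHS]powRr1 ?addr_ge0 ?lp_norm_ge0//.
rewrite -(mulfV p_neq0) !powRrM.
by apply: ge0_ler_powR; rewrite ?nnegrE ?powR_ge0 ?invr_ge0.
Qed.

Let nrmZ (a : R[i]) (xi : lp) : nrm (a *: xi) = `|a| * nrm xi.
Proof.
rewrite /nrm -[`|a|]/((Normc.normc a)%:C) -rmorphM; congr (_%:C).
apply/eqP; rewrite eq_le; apply/andP; split.
  apply: lp_norm_le_mul => [|i]; first exact: normc_ge0.
  by rewrite -rnormZ.
have [->|a0] := eqVneq a 0; first by rewrite Normc.normc0 mul0r lp_norm_ge0.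
have an0 : Normc.normc a != 0 by apply: contra a0 => /eqP/Normc.eq0_normc ->.
have a_gt0 : 0 < Normc.normc a by rewrite lt_def an0 normc_ge0.
rewrite mulrC -ler_pdivlMr// mulrC.
apply: lp_norm_le_mul => [|i]; first by rewrite invr_ge0 normc_ge0.
by rewrite -Normc.normcV -rnormZ -[(a *: xi) i]/(a *: xi i) scalerA mulVf// scale1r.
Qed.

Let nrm_eq0 (xi : lp) : nrm xi = 0 -> xi = 0.
Proof.
by move=> /complexI n0; apply/val_inj; apply: lp_norm_eq0 => //; exact: lp_fin.
Qed.

HB.instance Definition _ :=
  Lmodule_isNormed.Build R[i] lp ler_nrmD nrmZ nrm_eq0.

Lemma lp_rnormE (xi : lp) : rnorm xi = lp_norm xi. Proof. by []. Qed.

End LittleLp.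
Section LpAlgebras.
Context (R : realType) (p : R) (p1 : 1 <= p) (A : banachAlgType R[i]).

Definition Lp_operator_algebra : Prop :=
  exists d (X : measurableType d) (mu : {measure set X -> \bar R})
    (pi : contractive_rep A (Lp mu p1)),
  isometric_rep pi /\ closed (range pi).

Definition nondegenerately_sigma_finitely_representable : Prop :=
  exists d (X : measurableType d) (mu : {measure set X -> \bar R})
    (pi : contractive_rep A (Lp mu p1)),
  [/\ sigma_finite [set: X] mu, nondegenerate pi & isometric_rep pi].

End LpAlgebras.

Record isometric_action (R : realType) (G : groupType) (A : banachAlgType R[i]) :=
  IsometricAction {
  gact :> G -> A -> A;
  gact_linear : forall g, linear (gact g);
  gact_mul : forall g a b, gact g (a ** b) = gact g a ** gact g b;
  gact_bij : forall g, bijective (gact g);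
  gact_isometric : forall g a, `|gact g a| = `|a|;
  gact_hom : forall g h a, gact (g * h)%g a = gact g (gact h a)
}.

Section BmulTheory.
Context (K : numFieldType) (A : banachAlgType K).
Implicit Types a b : A.

Lemma bmul0r a : 0 ** a = 0.
Proof.
have := bmul_linearl a 1 0 0; rewrite !scale1r addr0 => /eqP.
by rewrite -subr_eq0 opprD addNKr oppr_eq0 => /eqP.
Qed.

Lemma bmulr0 a : a ** 0 = 0.
Proof.
have := bmul_linearr a 1 0 0; rewrite !scale1r addr0 => /eqP.
by rewrite -subr_eq0 opprD addNKr oppr_eq0 => /eqP.
Qed.

End BmulTheory.

Section Convolution.
Context (R : realType) (G : groupType) (A : banachAlgType R[i]).

Definition Cc_pred : {pred G -> A} := [pred f | `[< finite_set [set g | f g != 0] >]].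

Lemma Cc_submod_closed : submod_closed Cc_pred.
Proof.
split.
  by apply/asboolP; apply: sub_finite_set (finite_set0 G) => g /=; rewrite eqxx.
move=> a f h /asboolP ff /asboolP fh; apply/asboolP.
apply: sub_finite_set (_ : finite_set ([set g | f g != 0] `|` [set g | h g != 0])).
  move=> g /=; have [f0|f0] := eqVneq (f g) 0; last by left.
  have [h0|h0] := eqVneq (h g) 0; last by right.
  by rewrite -[(_ + h) g]/(a *: f g + h g) f0 h0 scaler0 addr0 eqxx.
by rewrite finite_setU.
Qed.

HB.instance Definition _ :=
  GRing.isSubmodClosed.Build R[i] (G -> A) Cc_pred Cc_submod_closed.

Record Cc := FinSuppFun { Cc_fun :> G -> A; Cc_prop : Cc_fun \in Cc_pred }.

HB.instance Definition _ := [isSub for Cc_fun].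
HB.instance Definition _ := [Choice of Cc by <:].
HB.instance Definition _ := [SubChoice_isSubLmodule of Cc by <:].

Lemma Cc_finite (f : Cc) : finite_set [set g | f g != 0].
Proof. exact/asboolP/Cc_prop. Qed.

Variable alpha : isometric_action G A.

Lemma gact0 g : alpha g 0 = 0.
Proof.
have := gact_linear alpha g 1 0 0; rewrite !scale1r addr0 => /eqP.
by rewrite -subr_eq0 opprD addNKr oppr_eq0 => /eqP.
Qed.

Lemma gact1 a : alpha 1%g a = a.
Proof. by apply: (bij_inj (gact_bij alpha 1%g)); rewrite -gact_hom mulg1. Qed.

Lemma gactVK g a : alpha g (alpha g^-1%g a) = a.
Proof. by rewrite -gact_hom mulgV gact1. Qed.

(* (\sum_g f_g u_g) (\sum_h h_h u_h) has k-th coefficient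
   \sum_g f_g alpha_g (h_{g^-1 k}), since (a u_g) (b u_h) = a alpha_g(b) u_gh *)
Definition Cc_conv (f h : G -> A) (k : G) : A :=
  \sum_(g \in [set: G]) f g ** alpha g (h (g^-1 * k)%g).

Lemma Cc_mul_subproof (f h : Cc) : Cc_conv f h \in Cc_pred.
Proof.
apply/asboolP.
pose S := [set (x * y)%g | x in [set g | f g != 0] & y in [set g | h g != 0]].
apply: (@sub_finite_set _ _ S) => [k /= /eqP k0|]; last first.
  by apply: finite_image2; exact: Cc_finite.
apply: contrapT => Sk; apply: k0; apply: fsbig1 => g _.
have [f0|f0] := eqVneq (f g) 0; first by rewrite f0 bmul0r.
have [h0|h0] := eqVneq (h (g^-1 * k)%g) 0; first by rewrite h0 gact0 bmulr0.
by case: Sk; exists g => //; exists (g^-1 * k)%g => //; rewrite mulVKg.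
Qed.

Definition Cc_mul (f h : Cc) : Cc := FinSuppFun (Cc_mul_subproof f h).

Lemma Cc_mono_subproof (a : A) (g : G) :
  (fun k => if k == g then a else 0) \in Cc_pred.
Proof.
apply/asboolP; apply: sub_finite_set (finite_set1 g) => k /=.
by case: (k =P g) => // _; rewrite eqxx.
Qed.

Definition Cc_mono (a : A) (g : G) : Cc := FinSuppFun (Cc_mono_subproof a g).

Lemma Cc_mul_mono a g b h :
  Cc_mul (Cc_mono a g) (Cc_mono b h) = Cc_mono (a ** alpha g b) (g * h)%g.
Proof.
apply/val_inj/funext => k /=; rewrite /Cc_conv.
rewrite -(@fsbig_widen _ _ _ _ [set g] setT)//=; last first.
  by move=> x [_ /= xg]; case: eqP => // _; rewrite bmul0r.
rewrite fsbig_set1 eqxx (can2_eq (mulVKg g) (mulKg g)).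
by case: eqP => // _; rewrite gact0 bmulr0.
Qed.

End Convolution.

Record covariant_rep (R : realType) (G : groupType) (A : banachAlgType R[i])
    (alpha : isometric_action G A) (E : normedModType R[i]) := CovariantRep {
  cov_v : G -> bop E E;
  cov_pi : contractive_rep A E;
  cov_v1 : cov_v 1%g = bid E;
  cov_vM : forall g h, cov_v (g * h)%g = cov_v g \bo cov_v h;
  cov_v_contractive : forall g, `|cov_v g| <= 1;
  cov_covariant : forall g a,
    cov_pi (alpha g a) = cov_v g \bo cov_pi a \bo cov_v g^-1%g
}.

Definition integrated_form (R : realType) (G : groupType) (A : banachAlgType R[i])
    (alpha : isometric_action G A) (E : normedModType R[i])
    (rho : covariant_rep alpha E) (f : Cc G A) : bop E E :=
  \sum_(g \in [set: G]) (cov_pi rho (f g) \bo cov_v rho g).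

Section RegularRepresentation.
Context (R : realType) (G : groupType) (A : banachAlgType R[i]).
Context (alpha : isometric_action G A) (E : normedModType R[i]).
Context (p : R) (p1 : 1 <= p) (pi0 : contractive_rep A E).

Local Notation lpGE := (lp G E p1).

Let lp_sum_transl g (xi : G -> E) :
  lp_sum p (fun h => xi (g^-1 * h)%g) = lp_sum p xi.
Proof.
rewrite /lp_sum [RHS](@reindex_esum R G G setT setT (fun h => g^-1 * h)%g)//.
rewrite setTT_bijective.
by exists (fun h => g * h)%g => h; rewrite ?mulKg ?mulVKg.
Qed.

Lemma regular_v_fun_subproof g (xi : lpGE) :
  (fun h => xi (g^-1 * h)%g) \in lp_pred p1.
Proof. by apply/asboolP; rewrite lp_sum_transl; exact: lp_fin. Qed.

Definition regular_v_fun g (xi : lpGE) : lpGE :=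
  LittleLp (regular_v_fun_subproof g xi).

Let regular_v_isometric g xi : rnorm (regular_v_fun g xi) = rnorm xi.
Proof. by rewrite !lp_rnormE /lp_norm lp_sum_transl. Qed.

Lemma regular_v_subproof g : regular_v_fun g \in @bounded_op R lpGE lpGE.
Proof.
apply: bounded_opP => [a x y|]; first exact: lp_eqP.
by exists 1 => xi; rewrite regular_v_isometric mul1r.
Qed.

Definition regular_v g : bop lpGE lpGE := Bop (regular_v_subproof g).

Let pi0_bound a h (x : E) : rnorm (pi0 (alpha h^-1%g a) x) <= rnorm a * rnorm x.
Proof.
apply: le_trans (opnorm_bound _ _) _; apply: ler_wpM2r; first exact: rnorm_ge0.
have := crep_contractive pi0 (alpha h^-1%g a).
by rewrite gact_isometric bop_normE rnormE lecR.
Qed.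

Lemma regular_pi_fun_subproof a (xi : lpGE) :
  (fun h => pi0 (alpha h^-1%g a) (xi h)) \in lp_pred p1.
Proof.
apply/asboolP.
apply: le_lt_trans (lp_sum_le_mul p1 (rnorm_ge0 a) (fun h => pi0_bound a h (xi h))) _.
by rewrite lte_mul_pinfty ?lee_fin ?powR_ge0//; exact: lp_fin.
Qed.

Definition regular_pi_fun a (xi : lpGE) : lpGE :=
  LittleLp (regular_pi_fun_subproof a xi).

Let regular_pi_bound a xi : rnorm (regular_pi_fun a xi) <= rnorm a * rnorm xi.
Proof.
by apply: lp_norm_le_mul => [|h]; [exact: rnorm_ge0|exact: pi0_bound].
Qed.

Lemma regular_pi_subproof a : regular_pi_fun a \in @bounded_op R lpGE lpGE.
Proof.
apply: bounded_opP => [c x y|]; first by apply: lp_eqP => h /=; exact: bop_linear.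
by exists (rnorm a) => xi; exact: regular_pi_bound.
Qed.

Definition regular_pi_op a : bop lpGE lpGE := Bop (regular_pi_subproof a).

Lemma regular_pi_linear : linear regular_pi_op.
Proof.
move=> c a b; apply: bop_eqP => xi; apply: lp_eqP => h /=.
by rewrite gact_linear crep_linear.
Qed.

Lemma regular_piM a b : regular_pi_op (a ** b) = regular_pi_op a \bo regular_pi_op b.
Proof.
apply: bop_eqP => xi; apply: lp_eqP => h /=.
by rewrite gact_mul crepM.
Qed.

Lemma regular_pi_contractive a : `|regular_pi_op a| <= `|a|.
Proof.
rewrite bop_normE rnormE lecR; apply: opnorm_le; first exact: rnorm_ge0.
exact: regular_pi_bound.
Qed.

Definition regular_pi : contractive_rep A lpGE :=
  ContractiveRep regular_pi_linear regular_piM regular_pi_contractive.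

Lemma regular_v1 : regular_v 1%g = bid lpGE.
Proof.
by apply: bop_eqP => xi; apply: lp_eqP => h /=; rewrite invg1 mul1g.
Qed.

Lemma regular_vM g h : regular_v (g * h)%g = regular_v g \bo regular_v h.
Proof.
by apply: bop_eqP => xi; apply: lp_eqP => k /=; rewrite invgM mulgA.
Qed.

Lemma regular_v_contractive g : `|regular_v g| <= 1.
Proof.
rewrite bop_normE -[1]/(1%:C) lecR; apply: opnorm_le => // xi.
by rewrite mul1r regular_v_isometric.
Qed.

Lemma regular_covariant g a :
  regular_pi (alpha g a) = regular_v g \bo regular_pi a \bo regular_v g^-1%g.
Proof.
apply: bop_eqP => xi; apply: lp_eqP => h /=.
by rewrite invgK mulVKg -gact_hom invgM invgK.
Qed.

Definition regular_rep : covariant_rep alpha lpGE :=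
  CovariantRep regular_v1 regular_vM regular_v_contractive regular_covariant.

End RegularRepresentation.

Section CrossedProducts.
Context (R : realType) (G : groupType) (A : banachAlgType R[i]).
Context (alpha : isometric_action G A) (p : R) (p1 : 1 <= p).

Definition full_seminorm (f : Cc G A) : R :=
  sup [set r | exists d (X : measurableType d) (mu : {measure set X -> \bar R})
      (rho : covariant_rep alpha (Lp mu p1)),
    [/\ sigma_finite [set: X] mu, nondegenerate (cov_pi rho) &
        r = rnorm (integrated_form rho f)]].

Definition reduced_seminorm (f : Cc G A) : R :=
  sup [set r | exists d (X : measurableType d) (mu : {measure set X -> \bar R})
      (pi0 : contractive_rep A (Lp mu p1)),
    [/\ sigma_finite [set: X] mu, nondegenerate pi0 &
        r = rnorm (integrated_form (regular_rep alpha p1 pi0) f)]].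

(* [F], with the canonical map [j], is the Hausdorff completion of
   C_c (G, A, alpha) in the seminorm [N]; this determines [F] up to isometric
   isomorphism. *)
Definition hausdorff_completion (N : Cc G A -> R) (F : banachAlgType R[i])
    (j : Cc G A -> F) : Prop :=
  [/\ linear j, forall f h, j (Cc_mul alpha f h) = j f ** j h,
      forall f, rnorm (j f) = N f & dense (range j)].

Definition full_crossed_product (F : banachAlgType R[i]) : Prop :=
  exists j : Cc G A -> F, hausdorff_completion full_seminorm j.

Definition reduced_crossed_product (F : banachAlgType R[i]) : Prop :=
  exists j : Cc G A -> F, hausdorff_completion reduced_seminorm j.

End CrossedProducts.

(* Main.v *)
Require Import Defs.
From HB Require Import structures.
From mathcomp Require Import all_boot all_order all_algebra.
From mathcomp Require Import all_classical all_reals all_analysis.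
From mathcomp Require Import complex.

Import Order.TTheory GRing.Theory Num.Theory.
Import numFieldNormedType.Exports.

Local Open Scope classical_set_scope.
Local Open Scope ring_scope.
Local Open Scope complex_scope.

(* In both crossed products F, the images of the elements a u_g have norm at
   most the norm of a and span a dense subspace; nothing else about the two
   seminorms matters. Let D be a continuous derivation from F to a dual
   bimodule. Amenability of A makes D inner on the image of A, so, after
   subtracting an inner derivation, D vanishes there. The functionals
   psi_g = D(u_g) u_g^-1 are then bounded, commute with the image of A, and
   satisfy psi_hg = u_h psi_g u_h^-1 + D(u_h) u_h^-1. A mean phi of psi over the
   amenable group G thus satisfies D(u_h) = phi u_h - u_h phi and commutes with A,
   so that D(x) = phi x - x phi for x = a u_h, and by density for all x in F. *)

(** * Bounded linear maps and density *)

Section LinearMaps.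
Context (R : realType) (V W : normedModType R[i]).

Lemma linear_continuousP (f : V -> W) : linear f ->
  continuous f <-> exists K : R, forall x, rnorm (f x) <= K * rnorm x.
Proof.
move=> lf.
pose fM := GRing.isLinear.Build R[i] V W _ f lf.
pose fL : {linear V -> W} := HB.pack f fM.
have -> : continuous f <-> bounded_near fL (nbhs 0).
  by split => [|] /(linear_bounded_continuous fL).
split=> [/linear_boundedP bf|[K bK]].
  have [[r s] fr] := filter_ex bf.
  (* The bound [r +i* s] is complex; comparing real parts leaves [r] as a real bound. *)
  exists r => x; move: (fr x); rewrite !rnormE lecE => /andP[_].
  by rewrite /= mulr0 subr0.
apply/linear_boundedP; exists K%:C; split; first by rewrite complex_real.
move=> r Kr x; apply: le_trans (_ : K%:C * `|x| <= _); last first.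
  by rewrite ler_wpM2r// ltW.
by rewrite !rnormE -rmorphM lecR.
Qed.

Lemma rnormN (x : V) : rnorm (- x) = rnorm x.
Proof. by rewrite /rnorm normrN. Qed.

Lemma dense_rnorm (S : set V) (x : V) (e : R) : dense S -> 0 < e ->
  exists2 y, S y & rnorm (x - y) < e.
Proof.
move=> dS e0; have e0C : 0 < e%:C by rewrite ltcR.
have [||y [xy Sy]] := dS (ball x e%:C).
- by exists x; exact: ballxx.
- exact: ball_open.
exists y => //; move: xy; rewrite -ball_normE /= rnormE ltcR.
exact.
Qed.

(** If [T x] were nonzero, a point [y] of the span closer to [x] than [rnorm (T x) / K] would give
    [T (x - y) = T x], against the bound [K]. *)
Lemma continuous_linear_dense_eq0 (T : V -> W) (S : set V) :
  linear T -> continuous T -> dense (linspan S) -> (forall s, S s -> T s = 0) ->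
  forall x, T x = 0.
Proof.
move=> lT cT dS TS0 x.
have [K bT] := (linear_continuousP _ lT).1 cT.
pose TM := GRing.isLinear.Build R[i] V W _ T lT.
pose TL : {linear V -> W} := HB.pack T TM.
have TS y : linspan S y -> T y = 0.
  move=> [n [c [s [Ss ->]]]]; rewrite -[T _]/(TL _) raddf_sum big1// => k _.
  transitivity (c k *: T (s k)); first exact: (linearZ_LR TL).
  by rewrite TS0// scaler0.
apply/rnorm_eq0/eqP; rewrite eq_le rnorm_ge0 andbT leNgt; apply/negP => Tx0.
have K0 : 0 < K.
  rewrite ltNge; apply/negP => Kle; move: Tx0; rewrite ltNge => /negP; apply.
  by apply: le_trans (bT x) _; rewrite mulr_le0_ge0// rnorm_ge0.
have [y Sy xy] := dense_rnorm _ x _ dS (divr_gt0 Tx0 K0).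
have Txy : T (x - y) = T x.
  by have := lT (-1) y x; rewrite (TS y Sy) scaler0 add0r scaleN1r addrC.
have := bT (x - y); rewrite Txy mulrC leNgt => /negP; apply.
by rewrite -ltr_pdivlMr.
Qed.

End LinearMaps.

(** * Complex-valued invariant means *)

Section ComplexMean.
Context (R : realType).

Definition cbounded {I : Type} (f : I -> R[i]) :=
  exists M : R, forall i, Normc.normc (f i) <= M.

Lemma normc_Re (z : R[i]) : `|complex.Re z| <= Normc.normc z.
Proof.
by case: z => x y /=; rewrite -sqrtr_sqr ler_sqrt ?addr_ge0 ?sqr_ge0// lerDl sqr_ge0.
Qed.

Lemma normc_Im (z : R[i]) : `|complex.Im z| <= Normc.normc z.
Proof.
by case: z => x y /=; rewrite -sqrtr_sqr ler_sqrt ?addr_ge0 ?sqr_ge0// lerDr sqr_ge0.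
Qed.

Lemma normc_le_ReIm (z : R[i]) :
  Normc.normc z <= `|complex.Re z| + `|complex.Im z|.
Proof.
case: z => x y /=; have xy0 : 0 <= `|x| + `|y| by rewrite addr_ge0.
rewrite -[leRHS]ger0_norm// -sqrtr_sqr ler_sqrt ?sqr_ge0// sqrrD !real_normK ?num_real//.
by rewrite lerD2r lerDl mulrn_wge0// mulr_ge0.
Qed.

(** The real mean acts on real and imaginary parts separately. Estimating each part by [M] gives the
    crude bound [M + M], which suffices for bounding averaged functionals. *)
Lemma amenable_group_complex_mean (G : groupType) : amenable_group R G ->
  exists m : (G -> R[i]) -> R[i],
  [/\ forall c f1 f2, cbounded f1 -> cbounded f2 ->
        m (fun g => c * f1 g + f2 g) = c * m f1 + m f2,
      forall f M, (forall g, Normc.normc (f g) <= M) ->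
        Normc.normc (m f) <= M + M,
      forall c, m (cst c) = c &
      forall f h, cbounded f -> m (fun g => f (h * g)%g) = m f].
Proof.
move=> [m [mD mpos m1 minv]].
have b0 (r : R) : exists M : R, forall g : G, `|cst r g| <= M by exists `|r|.
have m0 : m (cst 0) = 0.
  have := mD (-1) (cst 0) (cst 0) (b0 0) (b0 0).
  rewrite (_ : (fun _ => _) = cst 0).
    by rewrite mulN1r addNr.
  by apply/funext => g /=; rewrite mulr0 addr0.
have mc r : m (cst r) = r.
  rewrite -[RHS](mulr1 r) -m1 -[RHS]addr0 -m0 -mD//.
  by congr m; apply/funext => g /=; rewrite mulr1 addr0.
(* Positivity of the mean on [f + M] and on [M - f]. *)
have ble f (M : R) : (forall g, `|f g| <= M) -> `|m f| <= M.
  move=> fM; have bf : exists M : R, forall g, `|f g| <= M by exists M.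
  rewrite ler_norml; apply/andP; split.
    rewrite -subr_ge0 opprK -[X in _ + X]mc -[m f]mul1r -mD//.
    apply: mpos => [|g /=]; last first.
      by rewrite mul1r -lerBlDr sub0r; have := fM g; rewrite ler_norml => /andP[].
    exists (M + `|M|) => g /=; rewrite mul1r (le_trans (ler_normD _ _))//.
    by rewrite lerD2r.
  rewrite -subr_ge0 addrC -mulN1r -[X in _ + X]mc -mD//.
  apply: mpos => [|g /=]; last first.
    by rewrite mulN1r addrC subr_ge0; have := fM g; rewrite ler_norml => /andP[].
  exists (M + `|M|) => g /=; rewrite mulN1r (le_trans (ler_normD _ _))//.
  by rewrite normrN lerD2r.
have bRe (f : G -> R[i]) : cbounded f ->
    exists M : R, forall g, `|complex.Re (f g)| <= M.
  by move=> [M fM]; exists M => g; exact: le_trans (normc_Re _) (fM g).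
have bIm (f : G -> R[i]) : cbounded f ->
    exists M : R, forall g, `|complex.Im (f g)| <= M.
  by move=> [M fM]; exists M => g; exact: le_trans (normc_Im _) (fM g).
have bD (c : R) f1 f2 : (exists M : R, forall g : G, `|f1 g| <= M) ->
    (exists M : R, forall g, `|f2 g| <= M) ->
    exists M : R, forall g, `|c * f1 g + f2 g| <= M.
  move=> [M1 f1M] [M2 f2M]; exists (`|c| * M1 + M2) => g.
  by rewrite (le_trans (ler_normD _ _))// normrM lerD// ler_wpM2l.
exists (fun f => m (fun g => complex.Re (f g)) +i* m (fun g => complex.Im (f g))).
split.
- move=> [u v] f1 f2 /[dup] /bRe r1 /bIm i1 /[dup] /bRe r2 /bIm i2.
  (* Both parts are nested as [c * f + (c' * f' + f'')] so that [mD] applies twice. *)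
  rewrite (_ : (fun g => complex.Re _) = (fun g => u * complex.Re (f1 g) +
      (- v * complex.Im (f1 g) + complex.Re (f2 g)))); last first.
    by apply/funext => g; case: (f1 g) (f2 g) => ? ? [? ?] /=; rewrite mulNr addrA.
  rewrite (_ : (fun g => complex.Im _) = (fun g => u * complex.Im (f1 g) +
      (v * complex.Re (f1 g) + complex.Im (f2 g)))); last first.
    by apply/funext => g; case: (f1 g) (f2 g) => ? ? [? ?] /=; rewrite addrA.
  rewrite !mD//; try exact: bD.
  by apply/eqP; rewrite eq_complex /= mulNr !addrA !eqxx.
- move=> f M fM; apply: le_trans (normc_le_ReIm _) _ => /=.
  apply: lerD; apply: ble => g.
    exact: le_trans (normc_Re _) (fM g).
  exact: le_trans (normc_Im _) (fM g).
- by move=> [x y]; congr (_ +i* _); exact: mc.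
- move=> f h bf; congr (_ +i* _).
    exact: (minv (fun g => complex.Re (f g)) h (bRe _ bf)).
  exact: (minv (fun g => complex.Im (f g)) h (bIm _ bf)).
Qed.

End ComplexMean.
Arguments cbounded {R I} f.

(** * Functionals and their averages *)

Section DualApply.
Context (R : realType) (X : normedModType R[i]).
Implicit Types phi psi : dual X.

Lemma dual_addE phi psi x : (phi + psi) x = phi x + psi x. Proof. by []. Qed.

Lemma dual_subE phi psi x : (phi - psi) x = phi x - psi x. Proof. by []. Qed.

Lemma dual_scaleE c phi x : (c *: phi) x = c *: phi x. Proof. by []. Qed.

End DualApply.

(** The mean is taken at each point of [X]; the result is again a functional because the values lie
    in a dual space and the family is uniformly bounded. *)
Lemma mean_of_functionals (R : realType) (I : Type) (X : normedModType R[i])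
    (m : (I -> R[i]) -> R[i]) (psi : I -> dual X) (C : R) :
  (forall c f1 f2, cbounded f1 -> cbounded f2 ->
    m (fun i => c * f1 i + f2 i) = c * m f1 + m f2) ->
  (forall f M, (forall i, Normc.normc (f i) <= M) ->
    Normc.normc (m f) <= M + M) ->
  (forall i, rnorm (psi i) <= C) ->
  exists phi : dual X, forall x, phi x = m (fun i => psi i x).
Proof.
move=> mD mb psiC.
have bx x i : Normc.normc (psi i x) <= C * rnorm x.
  apply: le_trans (opnorm_bound (psi i) x) _.
  by rewrite ler_wpM2r ?rnorm_ge0//; exact: psiC.
have cb x : cbounded (fun i => psi i x) by exists (C * rnorm x).
have P : (fun x => m (fun i => psi i x)) \in @bounded_op R X (R[i])^o.
  apply: bounded_opP => [c x y|].
    rewrite -[RHS]/(c * _ + _) -mD//; congr m; apply/funext => i.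
    by rewrite bop_linear.
  by exists (C + C) => x; rewrite mulrDl; exact: mb.
by exists (Bop P).
Qed.

(** * Inner derivations into dual bimodules *)

Section DualActions.
Context (R : realType) (A : banachAlgType R[i]) (X : completeNormedModType R[i]).
Variable M : banach_bimodule A X.

Lemma dual_act_bounded : exists K : R, 0 <= K /\ forall a (phi : dual X),
  rnorm (dual_lact M a phi) <= K * rnorm a * rnorm phi /\
  rnorm (dual_ract M phi a) <= K * rnorm a * rnorm phi.
Proof.
(* The constant of [act_bounded] carries no sign condition, hence the absolute value. *)
have [K bK] := act_bounded M; exists `|K|; split=> // a phi.
have K0 : 0 <= `|K| * rnorm a * rnorm phi by rewrite !mulr_ge0 ?rnorm_ge0.
have KK (x : X) : K * rnorm a * rnorm x <= `|K| * rnorm a * rnorm x.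
  by rewrite !ler_wpM2r ?rnorm_ge0// ler_norm.
have KP y (x : X) : rnorm y <= K * rnorm a * rnorm x ->
    rnorm (phi y) <= `|K| * rnorm a * rnorm phi * rnorm x.
  move=> yx; apply: le_trans (opnorm_bound phi y) _. 
  rewrite -[opnorm phi]/(rnorm phi) mulrAC [leRHS]mulrC ler_wpM2l ?rnorm_ge0//.
  exact: le_trans yx (KK x).
by split; apply: (opnorm_le K0) => x; apply: KP; have [] := bK a x.
Qed.

Definition dual_ad (phi : dual X) (a : A) : dual X :=
  dual_lact M a phi - dual_ract M phi a.

Lemma dual_adE phi a x :
  dual_ad phi a x = phi (ract M x a) - phi (lact M a x).
Proof. by []. Qed.

Lemma dual_adD phi psi a : dual_ad (phi + psi) a = dual_ad phi a + dual_ad psi a.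
Proof.
by apply: bop_eqP => x; rewrite !(dual_addE, dual_adE) opprD addrACA.
Qed.

Lemma dual_ad_linear phi : linear (dual_ad phi).
Proof.
move=> c a b; apply: bop_eqP => x.
rewrite dual_adE [RHS]dual_addE dual_scaleE !dual_adE.
rewrite (lact_linearl M) (ract_linearr M) !bop_linear.
by rewrite scalerBr opprD addrACA.
Qed.

(** The two mixed terms, with [a] and [b] on opposite sides of [phi], cancel by [lractA]. *)
Lemma derivation_dual_ad phi : derivation M (dual_ad phi).
Proof.
split=> [|a b]; first exact: dual_ad_linear.
apply: bop_eqP => x.
rewrite dual_addE -[dual_lact _ _ _ x]/(dual_ad _ _ _) -[dual_ract _ _ _ x]/(dual_ad _ _ _).
by rewrite !dual_adE (ractA M) (lactA M) (lractA M) addrA subrK.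
Qed.

Lemma continuous_dual_ad phi : continuous (dual_ad phi).
Proof.
apply/(linear_continuousP R A (dual X) _ (dual_ad_linear phi)).
have [K [_ bM]] := dual_act_bounded.
exists (K * rnorm phi + K * rnorm phi) => a; rewrite mulrDl.
apply: le_trans (rnormD _ _) _; rewrite rnormN.
by have [l r] := bM a phi; rewrite lerD// mulrAC.
Qed.

Lemma derivationB (D E : A -> dual X) : derivation M D -> derivation M E ->
  derivation M (fun a => D a - E a).
Proof.
move=> [lD DM] [lE EM]; split=> [c a b|a b].
  by rewrite lD lE scalerBr opprD addrACA.
rewrite DM EM; apply: bop_eqP => x.
rewrite [RHS]dual_addE -[dual_lact _ _ _ x]/(bop_fun _ _) -[dual_ract _ _ _ x]/(bop_fun _ _).
by rewrite !(dual_addE, dual_subE) opprD addrACA.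
Qed.

End DualActions.

(** * Restriction of a bimodule along a homomorphism *)

Section Pullback.
Context (R : realType) (A F : banachAlgType R[i]) (X : completeNormedModType R[i]).
Variables (M : banach_bimodule F X) (iota : A -> F) (K : R).
Hypothesis iota_lin : linear iota.
Hypothesis iotaM : forall a b, iota (a ** b) = iota a ** iota b.
Hypothesis iota_bounded : forall a, rnorm (iota a) <= K * rnorm a.

Lemma pullback_act_bounded : exists N : R, forall a x,
  rnorm (lact M (iota a) x) <= N * rnorm a * rnorm x /\
  rnorm (ract M x (iota a)) <= N * rnorm a * rnorm x.
Proof.
have [N bN] := act_bounded M; exists (`|N| * K) => a x.
have Nle : N * rnorm (iota a) * rnorm x <= `|N| * K * rnorm a * rnorm x.
  rewrite ler_wpM2r ?rnorm_ge0// -mulrA.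
  apply: (@le_trans _ _ (`|N| * rnorm (iota a))).
    by rewrite ler_wpM2r ?rnorm_ge0// ler_norm.
  by rewrite ler_wpM2l.
by have [l r] := bN (iota a) x; split; exact: le_trans Nle.
Qed.

(** Kept transparent: the dual actions of [a] then agree by conversion with those of [iota a]. *)
Definition pullback_bimodule : banach_bimodule A X.
Proof.
apply: (@BanachBimodule R A X (fun a => lact M (iota a)) (fun x a => ract M x (iota a))).
- by move=> x c a b; rewrite iota_lin (lact_linearl M).
- by move=> a; exact: lact_linearr.
- by move=> a; exact: ract_linearl.
- by move=> x c a b; rewrite iota_lin (ract_linearr M).
- by move=> a b x; rewrite iotaM (lactA M).
- by move=> x a b; rewrite iotaM (ractA M).
- by move=> a x b; exact: lractA.
- exact: pullback_act_bounded.
Defined.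

(** Amenability of [A] is applied to [D \o iota], a continuous derivation into the dual of the
    pullback. *)
Lemma inner_on_range (D : F -> dual X) : amenable A ->
  derivation M D -> continuous D ->
  exists phi : dual X, forall a, D (iota a) = dual_ad R F X M phi (iota a).
Proof.
move=> Aam [lD DM] cD.
have lDi : linear (D \o iota) by move=> c a b /=; rewrite iota_lin lD.
have [phi Dphi] : inner_derivation pullback_bimodule (D \o iota).
  apply: Aam; first split=> // a b /=.
    by rewrite iotaM DM; apply: bop_eqP.
  apply/(linear_continuousP R A (dual X) _ lDi).
  have [L bD] := (linear_continuousP R F (dual X) D lD).1 cD.
  exists (`|L| * K) => a /=; apply: le_trans (bD _) _.
  rewrite -mulrA; apply: (@le_trans _ _ (`|L| * rnorm (iota a))).
    by rewrite ler_wpM2r ?rnorm_ge0// ler_norm.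
  by rewrite ler_wpM2l.
by exists phi => a; rewrite -[LHS]/((D \o iota) a) Dphi; apply: bop_eqP.
Qed.

End Pullback.

(** * Algebras generated by an amenable algebra and a bounded group *)

Section GroupGenerated.
Context (R : realType) (G : groupType) (A F : banachAlgType R[i]).
Variables (alpha : isometric_action G A) (iota : A -> F) (u : G -> F).
Variables (e : A) (K C : R).
Hypothesis iota_lin : linear iota.
Hypothesis iotaM : forall a b, iota (a ** b) = iota a ** iota b.
Hypothesis iota_bounded : forall a, rnorm (iota a) <= K * rnorm a.
Hypothesis u1 : u 1%g = iota e.
Hypothesis uM : forall g h, u (g * h)%g = u g ** u h.
Hypothesis u_bounded : forall g, rnorm (u g) <= C.
Hypothesis u_iota : forall g a, u g ** iota a = iota (alpha g a) ** u g.

Lemma derivation_inner_on_generators (X : completeNormedModType R[i])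
    (M : banach_bimodule F X) (d : F -> dual X) :
  amenable_group R G -> derivation M d -> continuous d ->
  (forall a, d (iota a) = 0) ->
  exists phi : dual X, forall a g,
    d (iota a ** u g) = dual_ad R F X M phi (iota a ** u g).
Proof.
move=> Gam [ld dd] cd diota.
have dM a b x : d (a ** b) x = d b (ract M x a) + d a (lact M b x).
  by rewrite dd.
(* Since [d] vanishes on the image of [A], it is a bimodule map over that image. *)
have diotal a b x : d (iota a ** b) x = d b (ract M x (iota a)).
  by rewrite dM diota addr0.
have diotar a b x : d (b ** iota a) x = d b (lact M (iota a) x).
  by rewrite dM diota add0r.
have [Kd bd] := (linear_continuousP R F (dual X) d ld).1 cd.
have [K2 [K20 bM]] := dual_act_bounded R F X M.
have C0 : 0 <= C by exact: le_trans (rnorm_ge0 (u 1%g)) (u_bounded 1%g).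
pose psi g := dual_ract M (d (u g)) (u g^-1%g).
have psiE g x : psi g x = d (u g) (lact M (u g^-1%g) x) by [].
have psiC g : rnorm (psi g) <= K2 * C * (`|Kd| * C).
  apply: le_trans (bM _ _).2 _; apply: ler_pM.
  - by rewrite mulr_ge0 ?rnorm_ge0.
  - exact: rnorm_ge0.
  - by rewrite ler_wpM2l.
  apply: le_trans (bd _) _; apply: (@le_trans _ _ (`|Kd| * rnorm (u g))).
    by rewrite ler_wpM2r ?rnorm_ge0// ler_norm.
  by rewrite ler_wpM2l.
have [m [mD mb mc minv]] := amenable_group_complex_mean R G Gam.
have [phi phiE] := mean_of_functionals R G X m psi _ mD mb psiC.
have cb x : cbounded (fun g => psi g x).
  exists (K2 * C * (`|Kd| * C) * rnorm x) => g.
  apply: le_trans (opnorm_bound (psi g) x) _.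
  by rewrite ler_wpM2r ?rnorm_ge0//; exact: psiC.
(* Already each [psi g] commutes with [iota a]: passing [u g^-1] and then [u g] twists [a] by
   [alpha g^-1] and then by [alpha g]. *)
have phi_iota a x : phi (ract M x (iota a)) = phi (lact M (iota a) x).
  rewrite !phiE; congr m; apply/funext => g; rewrite !psiE.
  rewrite -(lractA M) -diotal -(lactA M) u_iota (lactA M) -diotar u_iota.
  by rewrite gactVK.
(* [u 1] need not act as the identity on [X], but [psi g] absorbs it through its factor [u g^-1]. *)
have phi_u1 x : phi (lact M (u 1%g) x) = phi x.
  rewrite !phiE; congr m; apply/funext => g; rewrite !psiE.
  by rewrite -(lactA M) -uM mulg1.
(* Invariance replaces [psi g] by [psi (h * g)], which the derivation rule splits into a translate
   of [psi g] and a term constant in [g]; the mean fixes constants. *)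
have phi_u h x : phi x =
    phi (ract M (lact M (u h^-1%g) x) (u h)) + d (u h) (lact M (u h^-1%g) x).
  rewrite [LHS]phiE -(minv _ h (cb x)) phiE.
  rewrite -[X in _ + X]mc -[X in X + _]mul1r -mD//; last first.
    by exists (Normc.normc (d (u h) (lact M (u h^-1%g) x))).
  congr m; apply/funext => g; rewrite mul1r !psiE uM dM invgM uM (lactA M).
  have -> : lact M (u g) (lact M (u g^-1%g) (lact M (u h^-1%g) x)) =
      lact M (u h^-1%g) x.
    by rewrite -!(lactA M) -!uM mulgV mul1g.
  by rewrite (lractA M).
have d_u h x : d (u h) x = phi (lact M (u h) x) - phi (ract M x (u h)).
  rewrite (phi_u h (lact M (u h) x)) -(lactA M) -uM mulVg (lractA M) phi_u1.
  (* The module need not be unital, so [u 1] is moved into the derivation. *)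
  by rewrite addrAC subrr add0r u1 -diotar -u1 -uM mulg1.
(* The sign changes because [d_u] has the commutator in the order opposite to [dual_ad]. *)
exists (- phi) => a g; apply: bop_eqP => x.
rewrite diotal d_u -(lractA M) phi_iota dual_adE -(ractA M) -(lactA M).
by rewrite -[(- phi) _]/(- _) -[(- phi) (lact _ _ _)]/(- _) opprK addrC.
Qed.

(** Two corrections add up: [phi0] makes the derivation vanish on the image of [A], and [phi]
    implements the remainder [d] on the generators, hence on [F] by density. *)
Lemma amenable_group_generated : amenable_group R G -> amenable A ->
  dense (linspan [set y | exists a g, y = iota a ** u g]) -> amenable F.
Proof.
move=> Gam Aam dS X M D DM cD.
have [phi0 D0] := inner_on_range R A F X M iota K iota_lin iotaM iota_bounded D Aam DM cD.
pose d a := D a - dual_ad R F X M phi0 a.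
have cB (E : F -> dual X) phi : continuous E ->
    continuous (fun a => E a - dual_ad R F X M phi a).
  by move=> cE a; apply: cvgB; [exact: cE|exact: continuous_dual_ad].
have dd : derivation M d.
  by apply: derivationB => //; exact: derivation_dual_ad.
have cd : continuous d by exact: cB.
have d0 a : d (iota a) = 0 by rewrite /d D0 subrr.
have [phi dphi] := derivation_inner_on_generators X M d Gam dd cd d0.
exists (phi0 + phi) => a; rewrite -/(dual_ad R F X M (phi0 + phi) a) dual_adD.
apply/eqP; rewrite addrC -subr_eq -/(d a) -subr_eq0; apply/eqP.
apply: (continuous_linear_dense_eq0 R F (dual X)
  (fun a => d a - dual_ad R F X M phi a) _ _ _ dS).
- by have [] := derivationB _ _ _ M _ _ dd (derivation_dual_ad R F X M phi).
- exact: cB.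
- by move=> _ [b [g ->]]; rewrite dphi subrr.
Qed.

End GroupGenerated.

(** * Finitely supported functions as sums of monomials *)

Section FiniteSupport.
Context (R : realType) (G : groupType) (A : banachAlgType R[i]).

Lemma Cc_mono_linear (g : G) : linear (fun a : A => Cc_mono a g).
Proof.
move=> c a b; apply: val_inj; apply/funext => k.
rewrite -[RHS]/(c *: (if k == g then a else 0) + (if k == g then b else 0)) /=.
by case: (k == g); rewrite // scaler0 addr0.
Qed.

Lemma Cc_monoE (f : Cc G A) :
  f = \sum_(g <- finmap.enum_fset (fset_set [set g | f g != 0])) Cc_mono (f g) g.
Proof.
apply: val_inj; apply/funext => k; rewrite raddf_sum fct_sumE /=.
have [fk|fk] := eqVneq (f k) 0.
  rewrite big1_seq// => g; rewrite andTb => _.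
  by case: eqP => // <-.
rewrite (bigD1_seq k) ?finmap.fset_uniq//=; last first.
  by rewrite in_fset_set ?inE//; exact: Cc_finite.
rewrite eqxx big1 ?addr0// => g.
by rewrite eq_sym => /negPf ->.
Qed.

End FiniteSupport.

Lemma linspan_sum (K : numFieldType) (E : normedModType K) (S : set E)
    (I : Type) (r : seq I) (F : I -> E) :
  (forall i, S (F i)) -> linspan S (\sum_(i <- r) F i).
Proof.
(* The head [i0] serves as default for [nth], so the empty sum is treated apart. *)
move=> SF; case: r => [|i0 r].
  exists 0, (fun=> 0), (fun=> 0); split; first by case.
  by rewrite big_nil big_ord0.
exists (size (i0 :: r)), (fun=> 1), (fun k => F (nth i0 (i0 :: r) k)).
split=> // ; rewrite (big_nth i0) big_mkord.
by apply: eq_bigr => k _; rewrite scale1r.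
Qed.

(** * Crossed products as completions *)

Section CrossedProduct.
Context (R : realType) (G : groupType) (A : banachAlgType R[i]).
Context (alpha : isometric_action G A).

(** Only the term at [g] survives in the sum, and both of its factors come from contractive maps. *)
Lemma integrated_form_mono_le (E : normedModType R[i])
    (rho : covariant_rep alpha E) (a : A) (g : G) :
  rnorm (integrated_form rho (Cc_mono a g)) <= rnorm a.
Proof.
rewrite /integrated_form -(@fsbig_widen _ _ _ _ [set g] setT)//=; last first.
  move=> h [_ /= hg]; case: eqP => // _; apply: bop_eqP => x.
  have p0 : cov_pi rho 0 = 0.
    have := crep_linear (cov_pi rho) (-1) 0 0.
    by rewrite scaler0 addr0 scaleN1r addNr.
  by rewrite /= p0.
rewrite fsbig_set1 eqxx; apply: opnorm_le; first exact: rnorm_ge0.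
move=> x /=; apply: le_trans (opnorm_bound _ _) _.
apply: ler_pM; [exact: opnorm_ge0|exact: rnorm_ge0| |].
  by have := crep_contractive (cov_pi rho) a; rewrite bop_normE rnormE lecR.
apply: le_trans (opnorm_bound _ _) _; rewrite ler_piMl ?rnorm_ge0//.
by have := cov_v_contractive rho g; rewrite bop_normE -[1]/(1%:C) lecR.
Qed.

(** Nonnegativity of [x] covers an empty family of representations, whose supremum is [0] by
    convention. *)
Lemma sup_le_ge0 (S : set R) (x : R) : 0 <= x -> ubound S x -> sup S <= x.
Proof.
move=> x0 Sx; have [->|/set0P S0] := eqVneq S set0; first by rewrite sup0.
exact: ge_sup.
Qed.

Lemma full_seminorm_mono_le (p : R) (p1 : 1 <= p) a g :
  full_seminorm alpha p1 (Cc_mono a g) <= rnorm a.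
Proof.
apply: sup_le_ge0; first exact: rnorm_ge0.
by move=> _ [d [X [mu [rho [_ _ ->]]]]]; exact: integrated_form_mono_le.
Qed.

Lemma reduced_seminorm_mono_le (p : R) (p1 : 1 <= p) a g :
  reduced_seminorm alpha p1 (Cc_mono a g) <= rnorm a.
Proof.
apply: sup_le_ge0; first exact: rnorm_ge0.
by move=> _ [d [X [mu [pi0 [_ _ ->]]]]]; exact: integrated_form_mono_le.
Qed.

Lemma amenable_hausdorff_completion (N : Cc G A -> R) (F : banachAlgType R[i])
    (j : Cc G A -> F) :
  amenable_group R G -> unital A -> amenable A ->
  (forall a g, N (Cc_mono a g) <= rnorm a) ->
  hausdorff_completion alpha N j -> amenable F.
Proof.
move=> Gam [e eP] Aam Nmono [lj jM jN dj].
(* [alpha g e] is a left unit on the range of [alpha g], and [e] lies in that range. *)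
have alpha_e g : alpha g e = e.
  rewrite -[LHS](eP _).2 -{2}(gactVK alpha g e) -gact_mul (eP _).1.
  exact: gactVK.
have jmul a b g h : j (Cc_mono a g) ** j (Cc_mono b h) =
    j (Cc_mono (a ** alpha g b) (g * h)%g).
  by rewrite -jM Cc_mul_mono.
have jle a g : rnorm (j (Cc_mono a g)) <= rnorm a by rewrite jN.
(* The group is represented by the elements [e u_g], of norm at most [rnorm e]; no normalization of
   the unit is assumed. *)
apply: (amenable_group_generated R G A F alpha (fun a => j (Cc_mono a 1%g))
  (fun g => j (Cc_mono e g)) e 1 (rnorm e)) => //.
- by move=> c a b; rewrite Cc_mono_linear lj.
- by move=> a b; rewrite jmul gact1 mulg1.
- by move=> a; rewrite mul1r.
- by move=> g h; rewrite jmul alpha_e (eP e).1.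
- by move=> g a; rewrite !jmul alpha_e (eP _).1 (eP _).2 mulg1 mul1g.
(* The range of [j] is dense and lies in the span, since [f] is a finite sum of products of [f g] at
   [1] with [e] at [g]. *)
move=> O O0 Oo; have [y [Oy [f _ fy]]] := dj O O0 Oo.
exists y; split=> //; rewrite -fy (Cc_monoE _ _ _ f).
pose jm := GRing.isLinear.Build R[i] (Cc G A) F _ j lj.
pose jL : {linear Cc G A -> F} := HB.pack j jm.
rewrite -[j _]/(jL _) raddf_sum; apply: linspan_sum => g.
by exists (f g), g; rewrite jmul alpha_e (eP _).2 mul1g.
Qed.

End CrossedProduct.

Theorem theorem5p2 (R : realType) (p : R) (p1 : 1 <= p)
    (G : groupType) (Gcountable : countable [set: G])
    (Gamenable : amenable_group R G)
    (A : banachAlgType R[i]) (Aunital : unital A)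
    (ALp : Lp_operator_algebra p1 A)
    (Arep : nondegenerately_sigma_finitely_representable p1 A)
    (alpha : isometric_action G A)
    (Aamenable : amenable A) :
  (forall F : banachAlgType R[i],
     full_crossed_product alpha p1 F -> amenable F) /\
  (forall F : banachAlgType R[i],
     reduced_crossed_product alpha p1 F -> amenable F).
Proof.
split=> F [j jP]; apply: (amenable_hausdorff_completion _ _ _ _ _ _ _ _ _ _ _ jP) => //.
  by move=> a g; exact: full_seminorm_mono_le.
by move=> a g; exact: reduced_seminorm_mono_le.
Qed.
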